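(* Let $\Lambda=kQ/I$ be a Koszul quiver algebra with $\mathbb{K}$, $f^n_i$, $\varepsilon^n_i$ as in the context. Let the cocycles $\eta:\mathbb{K}_n\rightarrow\Lambda$ and $\theta:\mathbb{K}_m\rightarrow\Lambda$ represent elements in $\mathrm{HH}^*(\Lambda)$, given by $\eta(\varepsilon^n_i) = \lambda_i$ for $i=0,1,\ldots,t_n$ and $\theta(\varepsilon^m_j) = \beta_j$ for $j=0,1,\ldots,t_m$. Then the $r$-component of the bracket $[\eta, \theta] : \mathbb{K}_{n+m-1}\rightarrow\Lambda$, denoted by $[\eta, \theta]^{(r)}$, can be expressed on the $r$-th basis element $\varepsilon^{m+n-1}_r$ as $$[\eta, \theta]^{(r)}(\varepsilon^{m+n-1}_r) = \sum_{i=0}^{t_n} \sum_{j=0}^{t_m} \Big( b_{m+n-1,r}(n,i)\lambda_i - (-1)^{(m-1)(n-1)}b_{m+n-1,r}(m,j)\beta_j\Big)$$ provided $\lambda_i,\beta_j$ are all paths of length 1. Here, in the $(i,j)$ summand, $b_{m+n-1,r}(n,i)$ is the coefficient of $\varepsilon^n_i$ in $\psi_{\theta^{(j)}}(\varepsilon^{m+n-1}_r)$ and $b_{m+n-1,r}(m,j)$ is the coefficient of $\varepsilon^m_j$ in $\psi_{\eta^{(i)}}(\varepsilon^{m+n-1}_r)$.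
   Context: $k$ is a field, $\otimes=\otimes_k$ unless indicated, $\Lambda=kQ/I$ is a graded Koszul quiver algebra ($Q$ a finite quiver, $I$ an admissible ideal, paths concatenated left to right), $\Lambda^e=\Lambda\otimes\Lambda^{op}$, and $o(x),t(x)$ denote the origin and terminal vertex (identified with the corresponding idempotents) of a uniform element $x$, i.e. a nonzero linear combination of paths with common origin and common terminus. Put $R=kQ$. There are integers $t_n$ and uniform elements $\{f^n_i\}_{i=0}^{t_n}\subset R$, $n\ge 0$ ($f^0_i$ the vertices, $f^1_i$ the arrows, $f^2_i$ uniform relations generating $I$), with $\cdots\subseteq\bigoplus_i f^n_iR\subseteq\bigoplus_i f^{n-1}_iR\subseteq\cdots\subseteq R$, such that $\mathbb{L}_n=\bigoplus_i f^n_iR/\bigoplus_i f^n_iI$ with differentials induced by the inclusions is a minimal projective resolution of $\Lambda_0$ as a right $\Lambda$-module, and there are scalars $c_{pq}(n,i,r)$ with $$f^n_i=\sum_{p=0}^{t_r}\sum_{q=0}^{t_{n-r}}c_{pq}(n,i,r)f^r_pf^{n-r}_q\qquad(0\le r\le n).$$ These are fixed. The minimal projective $\Lambda^e$-resolution $\mathbb{K}\to\Lambda$ is $\mathbb{K}_n=\bigoplus_{i=0}^{t_n}\Lambda o(f^n_i)\otimes_k t(f^n_i)\Lambda$, with generators $\varepsilon^n_i=(0,\dots,0,o(f^n_i)\otimes_k t(f^n_i),0,\dots,0)$ ($i$-th position), and $$d_n(\varepsilon^n_i)=\sum_{j=0}^{t_{n-1}}\Big(\sum_{p=0}^{t_1}c_{p,j}(n,i,1)f^1_p\varepsilon^{n-1}_j+(-1)^n\sum_{q=0}^{t_1}c_{j,q}(n,i,n-1)\varepsilon^{n-1}_jf^1_q\Big),$$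 where $f^1_p$ also denotes its residue class in $\Lambda$; the augmentation $\mu=d_0:\mathbb{K}_0\to\Lambda$ is multiplication. A cocycle is a $\Lambda^e$-map $\eta:\mathbb{K}_n\to\Lambda$ with $\eta d_{n+1}=0$. The diagonal map is $$\Delta_{\mathbb{K}}(\varepsilon^n_r)=\sum_{v=0}^n\sum_{p=0}^{t_v}\sum_{q=0}^{t_{n-v}}c_{p,q}(n,r,v)\,\varepsilon^v_p\otimes_\Lambda\varepsilon^{n-v}_q .$$ For $\eta:\mathbb{K}_n\to\Lambda$ (extended by zero to other degrees), $(\eta\otimes 1)(x\otimes y)=\eta(x)y$ and $(1\otimes\eta)(x\otimes y)=(-1)^{n|x|}x\,\eta(y)$. A homotopy lifting map of $\eta:\mathbb{K}_n\to\Lambda$ is a $\Lambda^e$-module map $\psi_\eta:\mathbb{K}_m\to\mathbb{K}_{m-n+1}$ (all $m$) with $d\psi_\eta-(-1)^{n-1}\psi_\eta d=(\eta\otimes1-1\otimes\eta)\Delta_{\mathbb{K}}$ and $\psi_\eta|_{\mathbb{K}_{n-1}}=0$. One writes $\eta=\sum_{i=0}^{t_n}\eta^{(i)}$, where $\eta^{(i)}(\varepsilon^n_i)=\lambda_i$ and $\eta^{(i)}(\varepsilon^n_l)=0$ for $l\ne i$, and similarly $\theta=\sum_{j=0}^{t_m}\theta^{(j)}$ with $\theta^{(j)}(\varepsilon^m_j)=\beta_j$. The maps $\psi_{\eta^{(i)}},\psi_{\theta^{(j)}}$ are homotopy lifting maps of $\eta^{(i)},\theta^{(j)}$ which (all values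 being paths of length 1) are of the form: each generator $\varepsilon^l_r$ is sent to a scalar multiple $b_{l,r}(l',s)\varepsilon^{l'}_s$ of one generator, $l'$ being the target degree. The Gerstenhaber bracket is $[\eta,\theta]=\sum_{i,j}[\eta^{(i)},\theta^{(j)}]$ with $[\eta^{(i)},\theta^{(j)}]=\eta^{(i)}\psi_{\theta^{(j)}}-(-1)^{(m-1)(n-1)}\theta^{(j)}\psi_{\eta^{(i)}}$. The $r$-component of a map on $\mathbb{K}_{n+m-1}$ is the map agreeing with it on $\varepsilon^{n+m-1}_r$ and vanishing on the other generators. *)

(* Defs.v *)
From HB Require Import structures.
From mathcomp Require Import all_boot all_order all_algebra.
Set Warnings "-notation-incompatible-prefix,-deprecated".
From mathcomp Require Import finmap boolp monalg.

Set Implicit Arguments.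
Unset Strict Implicit.
Unset Printing Implicit Defensive.

Import GRing.Theory.
Local Open Scope ring_scope.
Local Open Scope quotient_scope.

Record quiver := Quiver {
  vertex : finType;
  arrow : finType;
  src : arrow -> vertex;
  tgt : arrow -> vertex;
  vertex0 : vertex
}.

Section Paths.
Variable Q : quiver.
Implicit Types (v : vertex Q) (s : seq (arrow Q)).

Fixpoint walk v s : bool :=
  if s is a :: s' then (src a == v) && walk (tgt a) s' else true.

Definition walk_end v s : vertex Q := last v (map (@tgt Q) s).

(* A path is its origin followed by its arrows, read from left to right. *)
Record qpath := QPath {
  qpath_val : vertex Q * seq (arrow Q);
  _ : walk qpath_val.1 qpath_val.2
}.
HB.instance Definition _ := [isSub for qpath_val].
HB.instance Definition _ := [Choice of qpath by <:].

Definition psrc (p : qpath) := (val p).1.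
Definition ptgt (p : qpath) := walk_end (val p).1 (val p).2.
Definition plen (p : qpath) := size (val p).2.

Definition path0 v : qpath := @QPath (v, [::]) isT.

Lemma walk1 (a : arrow Q) : walk (src a) [:: a].
Proof. by rewrite /= eqxx. Qed.
Definition path1 (a : arrow Q) : qpath := @QPath (src a, [:: a]) (walk1 a).

Lemma walk_cat v s1 s2 : walk v (s1 ++ s2) = walk v s1 && walk (walk_end v s1) s2.
Proof. by elim: s1 v => //= a s1 IH v; rewrite IH andbA. Qed.

Lemma walk_end_cat v s1 s2 : walk_end v (s1 ++ s2) = walk_end (walk_end v s1) s2.
Proof. by rewrite /walk_end map_cat last_cat. Qed.

Definition pcat (p q : qpath) : option qpath :=
  if ptgt p == psrc q then insub ((val p).1, (val p).2 ++ (val q).2) else None.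

Lemma pcatP p q : ptgt p = psrc q ->
  exists2 r, pcat p q = Some r & val r = ((val p).1, (val p).2 ++ (val q).2).
Proof.
move=> e; rewrite /pcat e eqxx; case: insubP => [r _ rE|]; first by exists r.
rewrite /= walk_cat; case: p q e => [p Hp] [q Hq]; rewrite /ptgt /psrc /= => ->.
by rewrite Hp Hq.
Qed.

Lemma pcatN p q : ptgt p != psrc q -> pcat p q = None.
Proof. by rewrite /pcat => /negPf ->. Qed.
End Paths.

Section LinearExtension.
Variables (R : nzRingType) (K : choiceType) (V : lmodType R).

Definition lext (g : K -> V) (x : {malg R[K]}) : V :=
  \sum_(p <- msupp x) x@_p *: g p.

Lemma lextw g (d : {fset K}) x : (msupp x `<=` d)%fset ->
  lext g x = \sum_(p <- d) x@_p *: g p.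
Proof.
move=> le; rewrite [LHS](big_fset_incl _ le) => //= p _ /mcoeff_outdom ->.
by rewrite scale0r.
Qed.

Lemma lext_is_linear g : linear (lext g).
Proof.
move=> c x y; pose d := (msupp x `|` msupp y)%fset.
rewrite (@lextw g d) ?(@lextw g d x) ?(@lextw g d y) ?fsubsetUl ?fsubsetUr //.
  rewrite scaler_sumr -big_split; apply: eq_bigr => p _ /=.
  by rewrite mcoeffD mcoeffZ scalerDl scalerA.
by apply: (fsubset_trans (msuppD_le _ _)); rewrite fsetSU // msuppZ_le.
Qed.
HB.instance Definition _ g :=
  GRing.isLinear.Build R {malg R[K]} V *:%R (lext g) (lext_is_linear g).

Lemma lextU g p : lext g << p >> = g p.
Proof. by rewrite (lextw _ msuppU_le) big_seq_fset1 mcoeffUU scale1r. Qed.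

Lemma eq_lext g h : g =1 h -> lext g =1 lext h.
Proof. by move=> gh x; apply: eq_bigr => p _; rewrite gh. Qed.

Lemma lextDg g h x : lext (fun p => g p + h p) x = lext g x + lext h x.
Proof. by rewrite -big_split; apply: eq_bigr => p _ /=; rewrite scalerDr. Qed.
End LinearExtension.

Lemma lextZg (R : comNzRingType) (K : choiceType) (V : lmodType R) c
  (g : K -> V) x : lext (fun p => c *: g p) x = c *: lext g x.
Proof.
rewrite /lext scaler_sumr; apply: eq_bigr => p _.
by rewrite !scalerA mulrC.
Qed.

Section MalgLinear.
Variables (R : nzRingType) (K : choiceType).
Lemma malg_linE (x : {malg R[K]}) : x = \sum_(p <- msupp x) x@_p *: << p >>.
Proof.
rewrite {1}[x]monalgE; apply: eq_bigr => p _; apply/malgP => q.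
by rewrite mcoeffZ !mcoeffU mulr_natr.
Qed.
End MalgLinear.

Lemma bilinear_assoc (R : pzRingType) (V : lmodType R) (I : Type) (mul : V -> V -> V)
    (b : I -> V) :
  left_distributive mul +%R -> right_distributive mul +%R ->
  (forall c x y, c *: mul x y = mul (c *: x) y) ->
  (forall c x y, c *: mul x y = mul x (c *: y)) ->
  (forall P : V -> Prop,
    (forall x y, P x -> P y -> P (x + y)) -> (forall c x, P x -> P (c *: x)) ->
    P 0 -> (forall i, P (b i)) -> forall x, P x) ->
  (forall i j l, mul (b i) (mul (b j) (b l)) = mul (mul (b i) (b j)) (b l)) ->
  associative mul.
Proof.
move=> Dl Dr Zl Zr ind bA.
have m0l x : mul 0 x = 0 by rewrite -[0 in LHS](scale0r 0) -Zl scale0r.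
have m0r x : mul x 0 = 0 by rewrite -[0 in LHS](scale0r 0) -Zr scale0r.
move=> x y z; move: x; apply: (ind _) => [x x' Hx Hx'|c x Hx||p].
- by rewrite !Dl Hx Hx'.
- by rewrite -!Zl Hx.
- by rewrite !m0l.
move: y; apply: (ind _) => [y y' Hy Hy'|c y Hy||q].
- by rewrite !(Dl, Dr) Hy Hy'.
- by rewrite -!(Zl, Zr) Hy.
- by rewrite !(m0l, m0r).
move: z; apply: (ind _) => [z z' Hz Hz'|c z Hz||r].
- by rewrite !Dr Hz Hz'.
- by rewrite -!Zr Hz.
- by rewrite !m0r.
exact: bA.
Qed.

Definition pathalg (k : fieldType) (Q : quiver) : Type := {malg k[qpath Q]}.

Section PathAlgebra.
Variables (k : fieldType) (Q : quiver).
Local Notation kQ := (pathalg k Q).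

HB.instance Definition _ := GRing.Lmodule.on kQ.

Definition pbasis (p : qpath Q) : kQ := << p >>.

Definition pathmul_basis (p q : qpath Q) : kQ :=
  if pcat p q is Some r then pbasis r else 0.

Definition pathmul (x y : kQ) : kQ :=
  lext (fun p => lext (pathmul_basis p) y) x.

Definition pathone : kQ := \sum_(v : vertex Q) pbasis (path0 v).

Lemma pathmulDl : left_distributive pathmul +%R.
Proof. by move=> x y z; exact: linearD. Qed.

Lemma pathmulDr : right_distributive pathmul +%R.
Proof.
move=> x y z; rewrite -[RHS]lextDg; apply: eq_lext => p; exact: linearD.
Qed.

Lemma pathmulZl c x y : c *: pathmul x y = pathmul (c *: x) y.
Proof. by apply/esym; exact: linearZ. Qed.

Lemma pathmulZr c x y : c *: pathmul x y = pathmul x (c *: y).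
Proof.
rewrite -[LHS]lextZg; apply: eq_lext => p; apply/esym; exact: linearZ.
Qed.

Lemma pathmul0l x : pathmul 0 x = 0.
Proof. exact: linear0. Qed.

Lemma pathmul0r x : pathmul x 0 = 0.
Proof. by rewrite -[0 in LHS](scale0r 0) -pathmulZr scale0r. Qed.

Lemma pathmul_suml I (r : seq I) (F : I -> kQ) x :
  pathmul (\sum_(i <- r) F i) x = \sum_(i <- r) pathmul (F i) x.
Proof. exact: linear_sum. Qed.

Lemma pathmul_sumr I (r : seq I) (F : I -> kQ) x :
  pathmul x (\sum_(i <- r) F i) = \sum_(i <- r) pathmul x (F i).
Proof.
by apply: (big_morph (pathmul x)) => [y z|]; rewrite ?pathmulDr ?pathmul0r.
Qed.

Lemma pathmulE p q : pathmul (pbasis p) (pbasis q) = pathmul_basis p q.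
Proof. by rewrite /pathmul !lextU. Qed.

Lemma pathalg_ind (P : kQ -> Prop) :
  (forall x y, P x -> P y -> P (x + y)) -> (forall c x, P x -> P (c *: x)) ->
  P 0 -> (forall p, P (pbasis p)) -> forall x, P x.
Proof.
move=> PD PZ P0 PB x; rewrite (malg_linE (x : {malg k[qpath Q]})).
by apply: (big_ind P) => // p _; exact: PZ (PB p).
Qed.

Lemma pathmul_basisA p q r :
  pathmul (pbasis p) (pathmul_basis q r) = pathmul (pathmul_basis p q) (pbasis r).
Proof.
rewrite /pathmul_basis; case: (eqVneq (ptgt q) (psrc r)) => [qr|nqr].
  have [s -> sE] := pcatP qr; rewrite pathmulE /pathmul_basis.
  case: (eqVneq (ptgt p) (psrc q)) => [pq|npq]; last first.
    rewrite pcatN; last by rewrite /psrc sE.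
    by rewrite pcatN // pathmul0l.
  have [t -> tE] := pcatP pq; rewrite pathmulE /pathmul_basis.
  have ps : ptgt p = psrc s by rewrite /psrc sE.
  have tr : ptgt t = psrc r.
    rewrite -qr /ptgt tE walk_end_cat.
    by rewrite -[walk_end (val p).1 _]/(ptgt p) pq.
  have [u -> uE] := pcatP ps; have [w -> wE] := pcatP tr.
  congr pbasis; apply: val_inj.
  by rewrite [LHS]uE [RHS]wE sE tE /= catA.
rewrite (pcatN nqr) pathmul0r.
case: (eqVneq (ptgt p) (psrc q)) => [pq|npq]; last by rewrite (pcatN npq) pathmul0l.
have [t -> tE] := pcatP pq; rewrite pathmulE /pathmul_basis pcatN //.
by rewrite /ptgt tE walk_end_cat -[walk_end (val p).1 _]/(ptgt p) pq.
Qed.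

Lemma pathmulA : associative pathmul.
Proof.
apply: (bilinear_assoc pathmulDl pathmulDr pathmulZl pathmulZr pathalg_ind).
move=> p q r; apply: etrans (congr1 (pathmul (pbasis p)) (pathmulE q r)) _.
apply: etrans (pathmul_basisA p q r) _.
by apply: (congr1 (fun u : kQ => pathmul u (pbasis r))); rewrite pathmulE.
Qed.

Lemma pathmul1 : left_id pathone pathmul.
Proof.
apply: pathalg_ind => [x y Hx Hy|c x Hx||p].
- by rewrite (pathmulDr _ x y) Hx Hy.
- by rewrite -(pathmulZr c _ x) Hx.
- exact: pathmul0r.
rewrite pathmul_suml (bigD1 (psrc p)) //= big1 ?addr0 => [|v nv];
  rewrite pathmulE /pathmul_basis.
  have [r -> rE] := @pcatP _ (path0 (psrc p)) p erefl.
  by congr pbasis; apply: val_inj; rewrite [LHS]rE [RHS]surjective_pairing.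
by rewrite pcatN.
Qed.

Lemma pathmulr1 : right_id pathone pathmul.
Proof.
apply: pathalg_ind => [x y Hx Hy|c x Hx||p].
- by rewrite (pathmulDl x y) Hx Hy.
- by rewrite -(pathmulZl c x) Hx.
- exact: pathmul0l.
rewrite pathmul_sumr (bigD1 (ptgt p)) //= big1 ?addr0 => [|v nv];
  rewrite pathmulE /pathmul_basis.
  have [r -> rE] := @pcatP _ p (path0 (ptgt p)) erefl.
  by congr pbasis; apply: val_inj; rewrite [LHS]rE [RHS]surjective_pairing cats0.
by rewrite pcatN // eq_sym.
Qed.

Lemma pathone_neq0 : pathone != 0.
Proof.
apply/eqP => /(congr1 (mcoeff (path0 (vertex0 Q)))).
rewrite mcoeff0 raddf_sum (bigD1 (vertex0 Q)) //= big1 ?addr0 => [|v nv].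
  by rewrite mcoeffU eqxx => /eqP; rewrite oner_eq0.
by rewrite mcoeffU -val_eqE /= xpair_eqE (negPf nv).
Qed.

HB.instance Definition _ := GRing.Zmodule_isNzRing.Build kQ
  pathmulA pathmul1 pathmulr1 pathmulDl pathmulDr pathone_neq0.
HB.instance Definition _ := GRing.Lmodule_isLalgebra.Build k kQ pathmulZl.
HB.instance Definition _ := GRing.Lalgebra_isAlgebra.Build k kQ pathmulZr.
End PathAlgebra.

(* An (A, B)-bimodule on which k acts centrally. A Lambda^e-module is a
   (Lambda, Lambda)-bimodule; k itself, as a k-algebra, is [k^o]. *)
Record bimodule (k : fieldType) (A B : algType k) := Bimodule {
  bimod_sort :> lmodType A;
  ract : bimod_sort -> B -> bimod_sort;
  ract1 : forall x, ract x 1 = x;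
  ractM : forall x b c, ract x (b * c) = ract (ract x b) c;
  ractDl : forall x y b, ract (x + y) b = ract x b + ract y b;
  ractDr : forall x b c, ract x (b + c) = ract x b + ract x c;
  ractA : forall a x b, ract (a *: x) b = a *: ract x b;
  ractk : forall (c : k) x, ract x c%:A = (c%:A : A) *: x
}.
Arguments ract {k A B M} : rename.
Notation "x <* b" := (ract x b) (at level 40, left associativity) : ring_scope.

Section BimoduleTheory.
Variables (k : fieldType) (A B : algType k) (M : bimodule A B).
Implicit Types (x : M) (b : B).

Lemma ract0l b : (0 : M) <* b = 0.
Proof. by apply: (addrI (0 <* b)); rewrite -ractDl !addr0. Qed.
Lemma ract0r x : x <* 0 = 0.
Proof. by apply: (addrI (x <* 0)); rewrite -ractDr !addr0. Qed.
Lemma ract_suml (I : Type) (r : seq I) (F : I -> M) b :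
  (\sum_(i <- r) F i) <* b = \sum_(i <- r) F i <* b.
Proof.
by apply: (big_morph (fun x : M => x <* b)) => [x y|]; rewrite ?ractDl ?ract0l.
Qed.
End BimoduleTheory.

Definition kscale (k : fieldType) (A B : algType k) (M : bimodule A B) (c : k)
  (x : M) : M := (c%:A : A) *: x.

Record bihom (k : fieldType) (A B : algType k) (M N : bimodule A B) := BiHom {
  bihom_fun :> {linear M -> N};
  bihom_ract : forall x b, bihom_fun (x <* b) = bihom_fun x <* b
}.

Section RegularBimodule.
Variables (k : fieldType) (A : algType k).
Definition regular_ract (x : A^o) (b : A) : A^o := (x : A) * b.
Fact regular_ract1 : forall x, regular_ract x 1 = x.
Proof. exact: mulr1. Qed.
Fact regular_ractM :
  forall x b c, regular_ract x (b * c) = regular_ract (regular_ract x b) c.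
Proof. exact: mulrA. Qed.
Fact regular_ractDl :
  forall x y b, regular_ract (x + y) b = regular_ract x b + regular_ract y b.
Proof. exact: mulrDl. Qed.
Fact regular_ractDr :
  forall x b c, regular_ract x (b + c) = regular_ract x b + regular_ract x c.
Proof. exact: mulrDr. Qed.
Fact regular_ractA :
  forall (a : A) x b, regular_ract (a *: x) b = a *: regular_ract x b.
Proof. by move=> a x b; exact: esym (mulrA a x b). Qed.
Fact regular_ractk :
  forall (c : k) x, regular_ract x (c%:A : A) = (c%:A : A) *: x.
Proof.
move=> c x; apply: etrans (_ : c *: (x : A) = _).
  by rewrite /regular_ract -scalerAr mulr1.
by apply: etrans (scalerAl c 1 (x : A)); rewrite mul1r.
Qed.
Definition regular_bimodule : bimodule A A :=
  @Bimodule k A A A^o regular_ract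
    regular_ract1 regular_ractM regular_ractDl regular_ractDr regular_ractA regular_ractk.
End RegularBimodule.

Section DirectSum.
Variables (R : nzRingType) (I : finType) (M : I -> lmodType R).

Definition dsum : Type := {dffun forall i, M i}.
HB.instance Definition _ := Choice.on dsum.
Implicit Types x y z : dsum.

Definition dsum0 : dsum := [ffun i => 0 : M i].
Definition dsum_opp x : dsum := [ffun i => - x i].
Definition dsum_add x y : dsum := [ffun i => x i + y i].

Fact dsum_addA : associative dsum_add.
Proof. by move=> x y z; apply/ffunP => i; rewrite !ffunE addrA. Qed.
Fact dsum_addC : commutative dsum_add.
Proof. by move=> x y; apply/ffunP => i; rewrite !ffunE addrC. Qed.
Fact dsum_add0 : left_id dsum0 dsum_add.
Proof. by move=> x; apply/ffunP => i; rewrite !ffunE add0r. Qed.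
Fact dsum_addN : left_inverse dsum0 dsum_opp dsum_add.
Proof. by move=> x; apply/ffunP => i; rewrite !ffunE addNr. Qed.
HB.instance Definition _ :=
  GRing.isZmodule.Build dsum dsum_addA dsum_addC dsum_add0 dsum_addN.

Lemma dsumD x y i : (x + y) i = x i + y i. Proof. by rewrite ffunE. Qed.

Definition dsum_scale (a : R) x : dsum := [ffun i => a *: x i].
Fact dsum_scaleA a b x : dsum_scale a (dsum_scale b x) = dsum_scale (a * b) x.
Proof. by apply/ffunP => i; rewrite !ffunE scalerA. Qed.
Fact dsum_scale1 : left_id 1 dsum_scale.
Proof. by move=> x; apply/ffunP => i; rewrite !ffunE scale1r. Qed.
Fact dsum_scaleDr : right_distributive dsum_scale +%R.
Proof. by move=> a x y; apply/ffunP => i; rewrite !ffunE scalerDr. Qed.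
Fact dsum_scaleDl x : {morph dsum_scale^~ x : a b / a + b}.
Proof. by move=> a b; apply/ffunP => i; rewrite !ffunE scalerDl. Qed.
HB.instance Definition _ := GRing.Zmodule_isLmodule.Build R dsum
  dsum_scaleA dsum_scale1 dsum_scaleDr dsum_scaleDl.

Lemma dsumZ a x i : (a *: x) i = a *: x i. Proof. by rewrite ffunE. Qed.
End DirectSum.

Section DirectSumBimodule.
Variables (k : fieldType) (A B : algType k) (I : finType) (M : I -> bimodule A B).

Definition dsum_ract (x : dsum M) (b : B) : dsum M := [ffun i => x i <* b].

Fact dsum_ract1 : forall x, dsum_ract x 1 = x.
Proof. by move=> x; apply/ffunP => i; rewrite !ffunE ract1. Qed.
Fact dsum_ractM :
  forall x b c, dsum_ract x (b * c) = dsum_ract (dsum_ract x b) c.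
Proof. by move=> x b c; apply/ffunP => i; rewrite !ffunE ractM. Qed.
Fact dsum_ractDl :
  forall x y b, dsum_ract (x + y) b = dsum_ract x b + dsum_ract y b.
Proof. by move=> x y b; apply/ffunP => i; rewrite !ffunE ractDl. Qed.
Fact dsum_ractDr :
  forall x b c, dsum_ract x (b + c) = dsum_ract x b + dsum_ract x c.
Proof. by move=> x b c; apply/ffunP => i; rewrite !ffunE ractDr. Qed.
Fact dsum_ractA :
  forall (a : A) x b, dsum_ract (a *: x) b = a *: dsum_ract x b.
Proof. by move=> a x b; apply/ffunP => i; rewrite !ffunE ractA. Qed.
Fact dsum_ractk :
  forall (c : k) x, dsum_ract x (c%:A : B) = (c%:A : A) *: x.
Proof. by move=> c x; apply/ffunP => i; rewrite !ffunE ractk. Qed.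
Definition dsum_bimodule : bimodule A B :=
  @Bimodule k A B (dsum M) dsum_ract
    dsum_ract1 dsum_ractM dsum_ractDl dsum_ractDr dsum_ractA dsum_ractk.

(* (0, ..., 0, u, 0, ..., 0) with u in position i. *)
Definition dsum_in (i : I) (u : M i) : dsum_bimodule :=
  finfun (dfwith (fun j => 0 : M j) u) : dsum M.
End DirectSumBimodule.

Section Tensor.
Variables (k : fieldType) (A B C : algType k).
Variables (M : bimodule A B) (N : bimodule B C).

(* M (x)_B N is the free abelian group on M * N modulo the subgroup generated
   by the biadditivity and B-balancedness relations. *)
Inductive tensor_rel : {malg int[(M * N)%type]} -> Prop :=
| TensorRel0 : tensor_rel 0
| TensorRelB u v : tensor_rel u -> tensor_rel v -> tensor_rel (u - v)
| TensorRelDl x x' y :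
    tensor_rel (<< (x + x', y) >> - << (x, y) >> - << (x', y) >>)
| TensorRelDr x y y' :
    tensor_rel (<< (x, y + y') >> - << (x, y) >> - << (x, y') >>)
| TensorRelA x b y : tensor_rel (<< (x <* b, y) >> - << (x, b *: y) >>).

Definition tensor_relb (u : {malg int[(M * N)%type]}) : bool := `[< tensor_rel u >].

Fact tensor_relb_zmod : zmod_closed tensor_relb.
Proof.
split; first by apply/asboolP; exact: TensorRel0.
by move=> u v /asboolP Hu /asboolP Hv; apply/asboolP; exact: TensorRelB.
Qed.
HB.instance Definition _ :=
  GRing.isZmodClosed.Build {malg int[(M * N)%type]} tensor_relb tensor_relb_zmod.

Definition tensor_ker : zmodClosed {malg int[(M * N)%type]} :=
  GRing.ZmodClosed.clone _ tensor_relb _.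

Definition tensor : Type := Quotient.quot tensor_ker.
HB.instance Definition _ := GRing.Zmodule.on tensor.

Definition tens (x : M) (y : N) : tensor := \pi_(Quotient.quot tensor_ker) << (x, y) >>.

Lemma tensor_pi0 u : tensor_rel u -> \pi_(Quotient.quot tensor_ker) u = 0.
Proof.
move=> Hu; rewrite -(raddf0 \pi_(Quotient.quot tensor_ker)).
by apply/eqP; rewrite -Quotient.idealrBE subr0; apply/asboolP.
Qed.

Lemma tensDl x x' y : tens (x + x') y = tens x y + tens x' y.
Proof.
apply/eqP; rewrite -subr_eq0 opprD addrA /tens -!raddfB; apply/eqP.
by apply: tensor_pi0; exact: TensorRelDl.
Qed.

Lemma tensDr x y y' : tens x (y + y') = tens x y + tens x y'.
Proof.
apply/eqP; rewrite -subr_eq0 opprD addrA /tens -!raddfB; apply/eqP.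
by apply: tensor_pi0; exact: TensorRelDr.
Qed.

Lemma tens_bal x b y : tens (x <* b) y = tens x (b *: y).
Proof.
apply/eqP; rewrite -subr_eq0 /tens -raddfB; apply/eqP.
by apply: tensor_pi0; exact: TensorRelA.
Qed.

Definition balanced (V : zmodType) (f : M -> N -> V) : Prop :=
  [/\ forall x x' y, f (x + x') y = f x y + f x' y,
      forall x y y', f x (y + y') = f x y + f x y' &
      forall x b y, f (x <* b) y = f x (b *: y)].

Definition malg_lift (V : zmodType) (f : M -> N -> V)
  (u : {malg int[(M * N)%type]}) : V := \sum_(p <- msupp u) f p.1 p.2 *~ u@_p.

(* The additive map M (x)_B N -> V, x (x) y |-> f x y; meaningful only for a
   balanced f, since a representative of t is chosen. *)
Definition tensor_lift (V : zmodType) (f : M -> N -> V) (t : tensor) : V :=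
  malg_lift f (repr (t : Quotient.quot tensor_ker)).

Section MalgLift.
Variables (V : zmodType) (f : M -> N -> V).

Lemma malg_liftw (d : {fset (M * N)%type}) u : (msupp u `<=` d)%fset ->
  malg_lift f u = \sum_(p <- d) f p.1 p.2 *~ u@_p.
Proof.
move=> le; rewrite /malg_lift (big_fset_incl _ le) => //= p _ /mcoeff_outdom ->.
by rewrite mulr0z.
Qed.

Lemma malg_lift_is_zmod_morphism : zmod_morphism (malg_lift f).
Proof.
move=> u v; pose d := (msupp u `|` msupp v)%fset.
rewrite (@malg_liftw d) ?(@malg_liftw d u) ?(@malg_liftw d v) ?fsubsetUl ?fsubsetUr //.
  by rewrite -sumrB; apply: eq_bigr => p _; rewrite mcoeffB mulrzBr.
exact: msuppB_le.
Qed.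
HB.instance Definition _ :=
  GRing.isZmodMorphism.Build {malg int[(M * N)%type]} V (malg_lift f)
    malg_lift_is_zmod_morphism.

Lemma malg_liftU p : malg_lift f << p >> = f p.1 p.2.
Proof. by rewrite (malg_liftw msuppU_le) big_seq_fset1 mcoeffUU. Qed.

Hypothesis bf : balanced f.

Lemma malg_lift0 u : tensor_rel u -> malg_lift f u = 0.
Proof.
case: bf => fDl fDr fA; elim => [|v w _ Hv _ Hw|x x' y|x y y'|x b y].
- exact: raddf0.
- by rewrite raddfB /= Hv Hw subr0.
- by rewrite !raddfB /= !malg_liftU /= fDl -addrA -opprD subrr.
- by rewrite !raddfB /= !malg_liftU /= fDr -addrA -opprD subrr.
- by rewrite raddfB /= !malg_liftU /= fA subrr.
Qed.

Lemma tensor_lift_pi u :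
  tensor_lift f (\pi_(Quotient.quot tensor_ker) u) = malg_lift f u.
Proof.
apply/eqP; rewrite -subr_eq0 -raddfB; apply/eqP/malg_lift0.
apply/asboolP; apply: etrans (Quotient.idealrBE tensor_ker _ _) _.
apply/eqP; exact: reprK.
Qed.

Lemma tensor_lift_tens x y : tensor_lift f (tens x y) = f x y.
Proof. by rewrite tensor_lift_pi malg_liftU. Qed.

Lemma tensor_lift_is_zmod_morphism : zmod_morphism (tensor_lift f).
Proof.
move=> s t; rewrite -[s](@reprK _ (Quotient.quot tensor_ker)).
rewrite -[t](@reprK _ (Quotient.quot tensor_ker)).
by rewrite -raddfB !tensor_lift_pi raddfB.
Qed.
End MalgLift.

Lemma tensor_ind (P : tensor -> Prop) :
  (forall s t, P s -> P t -> P (s - t)) -> (forall x y, P (tens x y)) -> forall t, P t.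
Proof.
move=> PB Pt t; have P0 : P 0 by rewrite -(subrr (tens 0 0)); apply: PB.
have PN s : P s -> P (- s) by move=> Ps; rewrite -[- s]add0r; apply: PB.
have PD s s' : P s -> P s' -> P (s + s').
  by move=> Ps Ps'; rewrite -[s']opprK; apply: PB => //; apply: PN.
have Pn s n : P s -> P (s *+ n).
  by move=> Ps; elim: n => [|n IH]; rewrite ?mulr0n // mulrS; apply: PD.
rewrite -[t](@reprK _ (Quotient.quot tensor_ker)) [repr _]monalgE raddf_sum /=.
apply: (big_ind P) => // p _; move: (_@_p) => z.
have -> : << z *g p >> = << p >> *~ z :> {malg int[(M * N)%type]}.
  by rewrite -{1}[z]intz raddfMz.
rewrite raddfMz; case: z => n; first by apply: Pn; case: p => x y; exact: Pt.
by apply: PN; apply: Pn; case: p => x y; exact: Pt.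
Qed.
End Tensor.
Arguments tens {k A B C M N} x y.

Section TensorBimodule.
Variables (k : fieldType) (A B C : algType k).
Variables (M : bimodule A B) (N : bimodule B C).
Local Notation T := (tensor M N).

Definition tensor_scale (a : A) : T -> T := tensor_lift (fun x y => tens (a *: x) y).
Definition tensor_ract (t : T) (c : C) : T := tensor_lift (fun x y => tens x (y <* c)) t.

Fact tensor_scale_bal a : balanced (fun (x : M) (y : N) => tens (a *: x) y : T).
Proof.
by split=> *; rewrite ?scalerDr ?tensDl ?tensDr // -ractA tens_bal.
Qed.
Fact tensor_ract_bal c : balanced (fun (x : M) (y : N) => tens x (y <* c) : T).
Proof. by split=> *; rewrite ?ractDl ?tensDl ?tensDr // ractA tens_bal. Qed.
Fact tensor_scaleB a : {morph tensor_scale a : s t / s - t}.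
Proof. exact: tensor_lift_is_zmod_morphism (tensor_scale_bal a). Qed.
Fact tensor_ractB c : {morph tensor_ract^~ c : s t / s - t}.
Proof. exact: tensor_lift_is_zmod_morphism (tensor_ract_bal c). Qed.
Lemma tensor_scaleE a x y : tensor_scale a (tens x y) = tens (a *: x) y.
Proof. exact: tensor_lift_tens (tensor_scale_bal a) x y. Qed.
Lemma tensor_ractE c x y : tensor_ract (tens x y) c = tens x (y <* c).
Proof. exact: tensor_lift_tens (tensor_ract_bal c) x y. Qed.
HB.instance Definition _ a :=
  GRing.isZmodMorphism.Build T T (tensor_scale a) (tensor_scaleB a).

Fact tensor_scaleA a b t : tensor_scale a (tensor_scale b t) = tensor_scale (a * b) t.
Proof.
elim/tensor_ind: t => [s t Hs Ht|x y]; first by rewrite !tensor_scaleB Hs Ht.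
by rewrite !tensor_scaleE scalerA.
Qed.
Fact tensor_scale1 : left_id 1 tensor_scale.
Proof.
elim/tensor_ind => [s t Hs Ht|x y]; first by rewrite tensor_scaleB Hs Ht.
by rewrite tensor_scaleE scale1r.
Qed.
Fact tensor_scaleDr : right_distributive tensor_scale +%R.
Proof. by move=> a s t; rewrite raddfD. Qed.
Fact tensor_scaleDl t : {morph tensor_scale^~ t : a b / a + b}.
Proof.
move=> a b; elim/tensor_ind: t => [s t Hs Ht|x y].
  by rewrite !tensor_scaleB Hs Ht opprD addrACA.
by rewrite !tensor_scaleE scalerDl tensDl.
Qed.
HB.instance Definition _ := GRing.Zmodule_isLmodule.Build A (tensor M N)
  tensor_scaleA tensor_scale1 tensor_scaleDr tensor_scaleDl.

Lemma tensZ a x y : a *: tens x y = tens (a *: x) y :> T.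
Proof. exact: tensor_scaleE. Qed.

Fact tensor_ractD c : {morph tensor_ract^~ c : s t / s + t}.
Proof.
move=> s t; have r0 : tensor_ract 0 c = 0
  by have := tensor_ractB c 0 0; rewrite /= !subrr.
by rewrite -[t in LHS]opprK -[- t]sub0r !tensor_ractB r0 sub0r opprK.
Qed.
Fact tensor_ract1 : forall x, tensor_ract x 1 = x.
Proof.
elim/tensor_ind => [s t Hs Ht|x y]; first by rewrite tensor_ractB Hs Ht.
by rewrite tensor_ractE ract1.
Qed.
Fact tensor_ractM :
  forall x b c, tensor_ract x (b * c) = tensor_ract (tensor_ract x b) c.
Proof.
move=> t b c; elim/tensor_ind: t => [s t Hs Ht|x y].
  by rewrite !tensor_ractB Hs Ht.
by rewrite !tensor_ractE ractM.
Qed.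
Fact tensor_ractDl :
  forall x y b, tensor_ract (x + y) b = tensor_ract x b + tensor_ract y b.
Proof. by move=> s t c; rewrite tensor_ractD. Qed.
Fact tensor_ractDr :
  forall x b c, tensor_ract x (b + c) = tensor_ract x b + tensor_ract x c.
Proof.
move=> t b c; elim/tensor_ind: t => [s t Hs Ht|x y].
  by rewrite !tensor_ractB Hs Ht opprD addrACA.
by rewrite !tensor_ractE ractDr tensDr.
Qed.
Fact tensor_ractA :
  forall (a : A) x b, tensor_ract (a *: x) b = a *: tensor_ract x b.
Proof.
move=> a t c; elim/tensor_ind: t => [s t Hs Ht|x y].
  by rewrite scalerBr !tensor_ractB scalerBr Hs Ht.
by rewrite tensZ !tensor_ractE tensZ.
Qed.
Fact tensor_ractk :
  forall (c : k) x, tensor_ract x (c%:A : C) = (c%:A : A) *: x.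
Proof.
move=> c t; elim/tensor_ind: t => [s t Hs Ht|x y].
  by rewrite scalerBr tensor_ractB Hs Ht.
by rewrite tensZ tensor_ractE ractk -tens_bal ractk.
Qed.
Definition tensor_bimodule : bimodule A C :=
  @Bimodule k A C T tensor_ract
    tensor_ract1 tensor_ractM tensor_ractDl tensor_ractDr tensor_ractA tensor_ractk.
End TensorBimodule.

Section CornerBimodules.
Variables (k : fieldType) (A : algType k) (e : A).

(* The left ideal A e and the right ideal e A of an idempotent e, as
   bimodules over (A, k) and (k, A). *)
Definition left_corner_pred : {pred A^o} := fun x : A => x * e == x.
Definition right_corner_pred : {pred A} := fun x : A => e * x == x.

Fact left_corner_submod : submod_closed left_corner_pred.
Proof.
split=> [|a x y /eqP xe /eqP ye]; first by apply/eqP; exact: mul0r.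
by apply/eqP; rewrite -[a *: x]/(a * x : A) mulrDl -mulrA xe ye.
Qed.
Fact right_corner_submod : submod_closed right_corner_pred.
Proof.
split=> [|c x y /eqP ex /eqP ey]; first by apply/eqP; exact: mulr0.
by apply/eqP; rewrite mulrDr -scalerAr ex ey.
Qed.
HB.instance Definition _ :=
  GRing.isSubmodClosed.Build A A^o left_corner_pred left_corner_submod.
HB.instance Definition _ :=
  GRing.isSubmodClosed.Build k A right_corner_pred right_corner_submod.

Record left_corner := LeftCorner {
  left_corner_val : A^o; _ : left_corner_val \in left_corner_pred }.
HB.instance Definition _ := [isSub for left_corner_val].
HB.instance Definition _ := [Choice of left_corner by <:].
HB.instance Definition _ := [SubChoice_isSubLmodule of left_corner by <:].

Record right_corner := RightCorner {
  right_corner_val : A; _ : right_corner_val \in right_corner_pred }.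
HB.instance Definition _ := [isSub for right_corner_val].
HB.instance Definition _ := [Choice of right_corner by <:].
HB.instance Definition _ := [SubChoice_isSubLmodule of right_corner by <:].

Fact left_corner_ract_subproof (x : left_corner) (c : k) :
  c *: (val x : A) \in left_corner_pred.
Proof. by case: x => x /= /eqP xe; apply/eqP; rewrite -scalerAl xe. Qed.
Definition left_corner_ract (x : left_corner) (c : k^o) : left_corner :=
  LeftCorner (left_corner_ract_subproof x c).

Fact right_corner_ract_subproof (x : right_corner) (b : A) :
  (val x : A) * b \in right_corner_pred.
Proof. by case: x => x /= /eqP ex; apply/eqP; rewrite mulrA ex. Qed.
Definition right_corner_ract (x : right_corner) (b : A) : right_corner :=
  RightCorner (right_corner_ract_subproof x b).

Fact left_corner_ract1 : forall x, left_corner_ract x 1 = x.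
Proof. by move=> x; apply: val_inj; rewrite /= scale1r. Qed.
Fact left_corner_ractM :
  forall x b c, left_corner_ract x (b * c) = left_corner_ract (left_corner_ract x b) c.
Proof. by move=> x b c; apply: val_inj; rewrite /= scalerA mulrC. Qed.
Fact left_corner_ractDl :
  forall x y b, left_corner_ract (x + y) b = left_corner_ract x b + left_corner_ract y b.
Proof.
by move=> x y b; apply: val_inj => /=; exact: (scalerDr b (val x : A) (val y : A)).
Qed.
Fact left_corner_ractDr :
  forall x b c, left_corner_ract x (b + c) = left_corner_ract x b + left_corner_ract x c.
Proof.
by move=> x b c; apply: val_inj => /=; exact: (scalerDl (val x : A) b c).
Qed.
Fact left_corner_ractA :
  forall (a : A) x b, left_corner_ract (a *: x) b = a *: left_corner_ract x b.
Proof.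
by move=> a x b; apply: val_inj => /=; exact: (scalerAr b a (val x : A)).
Qed.
Fact left_corner_ractk :
  forall (c : k) x, left_corner_ract x (c%:A : k^o) = (c%:A : A) *: x.
Proof.
move=> c x; apply: val_inj; rewrite (_ : c%:A = c :> k^o); last exact: mulr1.
apply: etrans (_ : (c *: 1) * (val x : A) = _) => //.
by rewrite -scalerAl mul1r.
Qed.
Definition left_corner_bimodule : bimodule A k^o :=
  @Bimodule k A k^o left_corner left_corner_ract
    left_corner_ract1 left_corner_ractM left_corner_ractDl
    left_corner_ractDr left_corner_ractA left_corner_ractk.

Fact right_corner_ract1 : forall x, right_corner_ract x 1 = x.
Proof. by move=> x; apply: val_inj; rewrite /= mulr1. Qed.
Fact right_corner_ractM :
  forall x b c, right_corner_ract x (b * c) = right_corner_ract (right_corner_ract x b) c.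
Proof. by move=> x b c; apply: val_inj; rewrite /= mulrA. Qed.
Fact right_corner_ractDl :
  forall x y b, right_corner_ract (x + y) b = right_corner_ract x b + right_corner_ract y b.
Proof. by move=> x y b; apply: val_inj; rewrite /= -mulrDl. Qed.
Fact right_corner_ractDr :
  forall x b c, right_corner_ract x (b + c) = right_corner_ract x b + right_corner_ract x c.
Proof. by move=> x b c; apply: val_inj; rewrite /= -mulrDr. Qed.
Fact right_corner_ractA :
  forall (a : k^o) x b, right_corner_ract (a *: x) b = a *: right_corner_ract x b.
Proof. by move=> a x b; apply: val_inj => /=; rewrite scalerAl. Qed.
Fact right_corner_ractk :
  forall (c : k) x, right_corner_ract x (c%:A : A) = (c%:A : k^o) *: x.
Proof.
move=> c x; apply: val_inj => /=; rewrite -scalerAr mulr1.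
by congr (_ *: _); rewrite -[RHS]/(c * 1) mulr1.
Qed.
Definition right_corner_bimodule : bimodule k^o A :=
  @Bimodule k k^o A right_corner right_corner_ract
    right_corner_ract1 right_corner_ractM right_corner_ractDl
    right_corner_ractDr right_corner_ractA right_corner_ractk.
End CornerBimodules.

Section Resolutions.
Variable R : nzRingType.

Definition surj (X Y : Type) (f : X -> Y) : Prop := forall y, exists x, f x = y.

Definition projective (P : lmodType R) : Prop :=
  forall (M N : lmodType R) (g : {linear M -> N}) (h : {linear P -> N}),
    surj g -> exists h' : {linear P -> M}, forall x, g (h' x) = h x.

Definition submodule (M : lmodType R) (U : M -> Prop) : Prop :=
  [/\ U 0, forall x y, U x -> U y -> U (x + y) & forall a x, U x -> U (a *: x)].

Definition superfluous (M : lmodType R) (U : M -> Prop) : Prop :=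
  forall V : M -> Prop, submodule V ->
    (forall x, exists u v, [/\ U u, V v & x = u + v]) -> forall x, V x.

Definition projective_resolution (P : nat -> lmodType R)
    (d : forall n, {linear P n.+1 -> P n}) (M : lmodType R)
    (aug : {linear P 0%N -> M}) : Prop :=
  [/\ forall n, projective (P n),
      surj aug,
      forall x, aug x = 0 <-> exists y, d 0%N y = x &
      forall n x, d n x = 0 <-> exists y, d n.+1 y = x].

(* Every P_n is a projective cover of the image of the map out of it. *)
Definition minimal_projective_resolution (P : nat -> lmodType R)
    (d : forall n, {linear P n.+1 -> P n}) (M : lmodType R)
    (aug : {linear P 0%N -> M}) : Prop :=
  [/\ projective_resolution d aug,
      superfluous (fun x => aug x = 0) &
      forall n, superfluous (fun x => d n x = 0)].
End Resolutions.

Section AdmissibleIdeals.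
Variables (k : fieldType) (Q : quiver).
Local Notation kQ := (pathalg k Q).

(* The power J^n of the arrow ideal J is spanned by the paths of length >= n. *)
Definition arrow_ideal_pow (n : nat) (x : kQ) : Prop :=
  forall p, p \in msupp x -> (n <= plen p)%N.

Definition homogeneous (n : nat) (x : kQ) : Prop :=
  forall p, p \in msupp x -> plen p = n.

Definition hom_comp (n : nat) (x : kQ) : kQ :=
  \sum_(p <- msupp x | plen p == n) x@_p *: pbasis k p.

Definition uniform (u v : vertex Q) (x : kQ) : Prop :=
  x != 0 /\ forall p, p \in msupp x -> psrc p = u /\ ptgt p = v.

Definition admissible (I : kQ -> Prop) : Prop :=
  (forall x, I x -> arrow_ideal_pow 2 x) /\
  (exists2 n, (2 <= n)%N & forall x, arrow_ideal_pow n x -> I x).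

Definition graded_ideal (I : kQ -> Prop) : Prop :=
  forall n x, I x -> I (hom_comp n x).

Definition ideal_generated (T : Type) (g : T -> kQ) (x : kQ) : Prop :=
  exists s : seq (kQ * T * kQ), x = \sum_(u <- s) u.1.1 * g u.1.2 * u.2.
End AdmissibleIdeals.

(* An algebra presented as kQ / I: a surjective algebra map kQ -> Lambda
   with kernel I (which is therefore a two-sided ideal). *)
Record quiver_algebra (k : fieldType) := QuiverAlgebra {
  qa_quiver : quiver;
  qa_ideal : pathalg k qa_quiver -> Prop;
  qa_alg :> algType k;
  qa_pr : {lrmorphism pathalg k qa_quiver -> qa_alg};
  qa_pr_surj : surj qa_pr;
  qa_pr_ker : forall x, qa_pr x = 0 <-> qa_ideal x;
  qa_admissible : admissible qa_ideal
}.
Arguments qa_ideal {k} _ _.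
Arguments qa_pr {k} _.

Section Koszul.
Variables (k : fieldType) (L : quiver_algebra k).
Local Notation Q := (qa_quiver L).
Local Notation kQ := (pathalg k Q).

Definition vertex_class (v : vertex Q) : L := qa_pr L (pbasis k (path0 v)).
Definition arrow_class (a : arrow Q) : L := qa_pr L (pbasis k (path1 a)).

Definition graded : Prop := graded_ideal (qa_ideal L).
Definition degree_part (n : nat) (a : L) : Prop :=
  exists2 x, homogeneous n x & qa_pr L x = a.
Definition positive_part (a : L) : Prop :=
  exists2 x, arrow_ideal_pow 1 x & qa_pr L x = a.

(* Right Lambda-modules are left modules over the converse ring [L^c]. *)
Local Notation rmodule := (lmodType L^c).

(* q exhibits S as the right module Lambda_0 = Lambda / Lambda_{>0}. *)
Definition is_degree0_module (S : rmodule) (q : {linear (L^c)^o -> S}) : Prop :=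
  surj q /\ forall a, q a = 0 <-> positive_part a.

(* Degrees in nat suffice: a module generated in degree n >= 0 over the
   nonnegatively graded Lambda has no component of negative degree. *)
Definition grading (P : rmodule) (gr : nat -> P -> Prop) : Prop :=
  [/\ forall i, gr i 0 /\ (forall x y, gr i x -> gr i y -> gr i (x - y)),
      forall i j x (a : L), gr i x -> degree_part j a ->
        gr (i + j)%N ((a : L^c) *: x),
      forall x, exists n (y : nat -> P),
        (forall i, gr i (y i)) /\ x = \sum_(i < n) y i &
      forall n (y : nat -> P), (forall i, gr i (y i)) ->
        \sum_(i < n) y i = 0 -> forall i, (i < n)%N -> y i = 0].

Definition generated_in_degree (P : rmodule) (gr : nat -> P -> Prop) (n : nat) :
    Prop :=
  forall x, exists (N : nat) (y : 'I_N -> P) (a : 'I_N -> L),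
    (forall i, gr n (y i)) /\ x = \sum_i (a i : L^c) *: y i.

(* Lambda_0 has a graded projective resolution whose n-th term is generated in
   degree n. *)
Definition koszul : Prop :=
  exists (S : rmodule) (q : {linear (L^c)^o -> S}) (P : nat -> rmodule)
    (d : forall n, {linear P n.+1 -> P n}) (aug : {linear P 0%N -> S})
    (gr : forall n, nat -> P n -> Prop),
  [/\ is_degree0_module q, projective_resolution d aug,
      forall n, grading (gr n) /\ generated_in_degree (gr n) n,
      forall n i x, gr n.+1 i x -> gr n i (d n x) &
      forall i x, (0 < i)%N -> gr 0%N i x -> aug x = 0].

(* The right modules (+)_i f_i R and (+)_i f_i I, inside R = kQ. *)
Definition right_span (T : finType) (f : T -> kQ) (x : kQ) : Prop :=
  exists r : T -> kQ, x = \sum_i f i * r i.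
Definition right_span_ideal (T : finType) (f : T -> kQ) (x : kQ) : Prop :=
  exists2 r : T -> kQ, (forall i, qa_ideal L (r i)) & x = \sum_i f i * r i.
Definition right_direct (T : finType) (f : T -> kQ) : Prop :=
  forall r : T -> kQ, \sum_i f i * r i = 0 -> forall i, f i * r i = 0.

(* q, restricted to (+)_i f_i R, exhibits P as the right Lambda-module
   (+)_i f_i R / (+)_i f_i I. *)
Definition is_span_quotient (T : finType) (f : T -> kQ) (P : rmodule)
    (q : kQ -> P) : Prop :=
  [/\ forall x y, right_span f x -> right_span f y -> q (x + y) = q x + q y,
      forall x r, right_span f x -> q (x * r) = (qa_pr L r : L^c) *: q x,
      forall y, exists2 x, right_span f x & q x = y &
      forall x, right_span f x -> (q x = 0 <-> right_span_ideal f x)].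

(* The modules L_n = (+)_i f^n_i R / (+)_i f^n_i I, with the differentials
   induced by inclusion, are a minimal projective resolution of Lambda_0. *)
Definition resolves_degree0 (num : nat -> nat)
    (f : forall n, 'I_(num n) -> kQ) : Prop :=
  exists (S : rmodule) (q0 : {linear (L^c)^o -> S}) (P : nat -> rmodule)
    (q : forall n, kQ -> P n) (d : forall n, {linear P n.+1 -> P n})
    (aug : {linear P 0%N -> S}),
  [/\ is_degree0_module q0,
      forall n, is_span_quotient (f n) (q n),
      forall n x, right_span (f n.+1) x -> d n (q n.+1 x) = q n x,
      forall x, aug (q 0%N x) = q0 (qa_pr L x) &
      minimal_projective_resolution d aug].

(* The elements f^n_i, 'I_(num n) indexing the f^n_i of degree n (so that
   num n = t_n + 1, or 0 when there are none), with their origins and termini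
   and the scalars c_{pq}(n,i,r) = [f_coef n r (n - r) i p q]. *)
Record koszul_data := KoszulData {
  num : nat -> nat;
  f_elt : forall n, 'I_(num n) -> kQ;
  f_org : forall n, 'I_(num n) -> vertex Q;
  f_ter : forall n, 'I_(num n) -> vertex Q;
  f_coef : forall n r s, 'I_(num n) -> 'I_(num r) -> 'I_(num s) -> k;
  f_uniform : forall n i, uniform (f_org i) (f_ter i) (@f_elt n i);
  f_vertices : exists2 v : 'I_(num 0) -> vertex Q, bijective v &
    forall i, f_elt i = pbasis k (path0 (v i));
  f_arrows : exists2 a : 'I_(num 1) -> arrow Q, bijective a &
    forall i, f_elt i = pbasis k (path1 (a i));
  f_relations : forall x, qa_ideal L x <-> ideal_generated (@f_elt 2) x;
  f_direct : forall n, right_direct (@f_elt n);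
  f_nested : forall n x, right_span (@f_elt n.+1) x -> right_span (@f_elt n) x;
  f_resolution : resolves_degree0 f_elt;
  f_comult : forall n r s i, n = (r + s)%N ->
    @f_elt n i = \sum_p \sum_q f_coef i p q *: (@f_elt r p * @f_elt s q)
}.
End Koszul.
Arguments vertex_class {k L}.
Arguments arrow_class {k L}.
Arguments f_elt {k L} _ {n}.
Arguments f_org {k L} _ {n}.
Arguments f_ter {k L} _ {n}.
Arguments f_coef {k L} _ {n r s}.

Section BimoduleResolution.
Variables (k : fieldType) (L : quiver_algebra k) (F : koszul_data L).

Definition K_summand (n : nat) (i : 'I_(num F n)) : bimodule L L :=
  tensor_bimodule (left_corner_bimodule (vertex_class (f_org F i)))
                  (right_corner_bimodule (vertex_class (f_ter F i))).

Definition K (n : nat) : bimodule L L := dsum_bimodule (@K_summand n).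

Lemma vertex_class_idem (v : vertex (qa_quiver L)) :
  vertex_class v * vertex_class v = vertex_class v :> L.
Proof.
rewrite -rmorphM; congr (qa_pr L _); apply: etrans (pathmulE k _ _) _.
rewrite /pathmul_basis; have [r -> rE] := @pcatP _ (path0 v) (path0 v) erefl.
by congr pbasis; apply: val_inj; rewrite [LHS]rE.
Qed.

Fact vertex_class_left v :
  vertex_class v \in left_corner_pred (vertex_class v : L).
Proof. by apply/eqP; exact: vertex_class_idem. Qed.
Fact vertex_class_right v :
  vertex_class v \in right_corner_pred (vertex_class v : L).
Proof. by apply/eqP; exact: vertex_class_idem. Qed.

Definition eps (n : nat) (i : 'I_(num F n)) : K n :=
  dsum_in (M := @K_summand n) (i := i)
    (@tens _ _ _ _
       (left_corner_bimodule (vertex_class (f_org F i)))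
       (right_corner_bimodule (vertex_class (f_ter F i)))
       (LeftCorner (vertex_class_left (f_org F i)))
       (RightCorner (vertex_class_right (f_ter F i)))).

(* The bimodule map K_n -> M with eps^n_i |-> m_i, for m_i in o(f^n_i) M t(f^n_i);
   in general eps^n_i |-> o(f^n_i) m_i t(f^n_i). *)
Section Extension.
Variables (M : bimodule L L) (n : nat) (m : 'I_(num F n) -> M).

Definition K_summand_ext (i : 'I_(num F n)) : K_summand i -> M :=
  tensor_lift (fun (a : left_corner_bimodule (vertex_class (f_org F i)))
                   (b : right_corner_bimodule (vertex_class (f_ter F i))) =>
    (left_corner_val a : L) *: m i <* right_corner_val b).

Definition K_ext_fun (x : K n) : M := \sum_i K_summand_ext ((x : dsum _) i).

Fact K_summand_ext_bal i :
  balanced (fun (a : left_corner_bimodule (vertex_class (f_org F i)))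
                   (b : right_corner_bimodule (vertex_class (f_ter F i))) =>
    (left_corner_val a : L) *: m i <* right_corner_val b).
Proof.
split=> [a a' b|a b b'|a c b].
- by rewrite -ractDl -scalerDl.
- by rewrite -ractDr.
- have -> : left_corner_val (a <* c) = (left_corner_val a : L) * c%:A.
    by rewrite -scalerAr mulr1.
  have -> : right_corner_val (c *: b) = c%:A * (right_corner_val b : L).
    by apply: etrans (scalerAl c 1 _); rewrite mul1r.
  by rewrite ractM -scalerA !ractA ractk ractA.
Qed.

Fact K_summand_ext_bihom i :
  [/\ forall x y, @K_summand_ext i (x - y) = K_summand_ext x - K_summand_ext y,
      forall a x, @K_summand_ext i (a *: x) = a *: K_summand_ext x &
      forall x a, @K_summand_ext i (x <* a) = K_summand_ext x <* a].
Proof.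
have lB (x y : K_summand i) :
    K_summand_ext (x - y) = K_summand_ext x - K_summand_ext y.
  exact: tensor_lift_is_zmod_morphism (K_summand_ext_bal i) x y.
have lE u v : @K_summand_ext i (tens u v) =
    (left_corner_val u : L) *: m i <* right_corner_val v.
  exact: tensor_lift_tens (K_summand_ext_bal i) u v.
have rB (N : bimodule L L) (u v : N) (a : L) : (u - v) <* a = u <* a - v <* a.
  by apply/eqP; rewrite eq_sym subr_eq -ractDl subrK.
split=> // [a|x a].
  elim/tensor_ind => [s t Hs Ht|u v].
    transitivity (K_summand_ext (a *: (s : K_summand i) - a *: (t : K_summand i))).
      by congr K_summand_ext; exact: scalerBr.
    by rewrite lB Hs Ht -scalerBr -lB.
  transitivity (K_summand_ext (tens (a *: u) v : K_summand i)).
    by congr K_summand_ext; exact: tensZ.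
  apply: etrans (lE _ _) _; apply: esym; apply: etrans (congr1 _ (lE u v)) _.
  by rewrite -ractA scalerA.
elim/tensor_ind: x => [s t Hs Ht|u v].
  transitivity (K_summand_ext ((s : K_summand i) <* a - (t : K_summand i) <* a)).
    by congr K_summand_ext; exact: rB.
  by rewrite lB Hs Ht -rB -lB.
transitivity (K_summand_ext (tens u (v <* a) : K_summand i)).
  by congr K_summand_ext; exact: tensor_ractE.
apply: etrans (lE _ _) _; apply: esym.
apply: etrans (congr1 (fun z : M => z <* a) (lE u v)) _.
by rewrite -ractM.
Qed.

Fact K_ext_linear : linear K_ext_fun.
Proof.
move=> a x y; rewrite /K_ext_fun scaler_sumr -big_split; apply: eq_bigr => i _ /=.
have [eB eZ _] := K_summand_ext_bihom i.
have eD (u v : K_summand i) :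
    K_summand_ext (u + v) = K_summand_ext u + K_summand_ext v.
  by apply/eqP; rewrite -subr_eq -eB addrK.
by rewrite dsumD dsumZ eD eZ.
Qed.
HB.instance Definition _ :=
  GRing.isLinear.Build L (K n) M *:%R K_ext_fun K_ext_linear.

Fact K_ext_ract x a : K_ext_fun (x <* a) = K_ext_fun x <* a.
Proof.
rewrite /K_ext_fun ract_suml; apply: eq_bigr => i _.
by have [_ _ <-] := K_summand_ext_bihom i; rewrite ffunE.
Qed.

Definition K_ext : bihom (K n) M := @BiHom _ _ _ (K n) M K_ext_fun K_ext_ract.

Lemma K_ext_eps i :
  K_ext (eps i) = vertex_class (f_org F i) *: m i <* vertex_class (f_ter F i).
Proof.
rewrite /= /K_ext_fun (bigD1 i) //= big1 ?addr0 => [|j ji].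
  rewrite /eps /dsum_in ffunE dfwith_in.
  by rewrite /K_summand_ext (tensor_lift_tens (K_summand_ext_bal i)).
rewrite /eps /dsum_in ffunE dfwith_out 1?eq_sym //.
have [eB _ _] := K_summand_ext_bihom j.
by rewrite -(subr0 0) eB subrr.
Qed.
End Extension.

Local Notation f1 p := (qa_pr L (f_elt F (n := 1) p)).

Definition K_d (n : nat) : bihom (K n) (K n.-1) :=
  match n return bihom (K n) (K n.-1) with
  | 0 => K_ext (fun _ => 0)
  | n'.+1 => K_ext (fun i => \sum_(j < num F n')
      (\sum_(p < num F 1) kscale (f_coef F i p j) (f1 p *: eps j) +
       kscale ((-1) ^+ n'.+1)
         (\sum_(q < num F 1) kscale (f_coef F i j q) (eps j <* f1 q))))
  end.

(* The component K_n -> K_v (x)_Lambda K_w, for n = v + w, of the diagonal map. *)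
Definition K_diag (n v w : nat) : bihom (K n) (tensor_bimodule (K v) (K w)) :=
  K_ext (fun r => \sum_(p < num F v) \sum_(q < num F w)
    kscale (f_coef F r p q) (tens (eps p) (eps q) : tensor_bimodule (K v) (K w))).

Local Notation cochain n := (bihom (K n) (regular_bimodule L)).

Definition cocycle (n : nat) (eta : cochain n) : Prop :=
  forall x, eta (K_d n.+1 x) = 0.

(* eta (x) 1 on K_n (x) K_w and 1 (x) eta on K_w (x) K_n; eta being extended
   by zero, these are the only components of K (x) K where they are nonzero. *)
Definition tensor_left (n w : nat) (eta : cochain n) :
    tensor_bimodule (K n) (K w) -> K w :=
  tensor_lift (fun x y => (eta x : L) *: y).
Definition tensor_right (n w : nat) (eta : cochain n) :
    tensor_bimodule (K w) (K n) -> K w :=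
  tensor_lift (fun x y => kscale ((-1) ^+ (n * w)) (x <* (eta y : L))).

(* psi l l' is the component K_l -> K_l' of psi, nonzero only for l' = l - n + 1.
   The equation is the one between maps K_(w + n) -> K_w; as K_d 0 = 0, it also
   covers the case w + n = 0. *)
Definition homotopy_lifting (n : nat) (eta : cochain n)
    (psi : forall l l', bihom (K l) (K l')) : Prop :=
  [/\ forall l l', (l' + n)%N <> l.+1 -> forall x, psi l l' x = 0,
      forall w (x : K (w + n)),
        K_d w.+1 (psi (w + n)%N w.+1 x)
          - kscale ((-1) ^ (n%:Z - 1)) (psi (w + n).-1 w (K_d (w + n) x))
        = tensor_left eta (K_diag (w + n) n w x)
          - tensor_right eta (K_diag (w + n) w n x) &
      forall l, l.+1 = n -> forall x, psi l 0%N x = 0].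

(* Every generator eps^l_r is sent to a scalar multiple of one generator;
   b l r l' s is the coefficient of eps^l'_s. *)
Definition monomial_coefs (n : nat) (psi : forall l l', bihom (K l) (K l'))
    (b : forall l, 'I_(num F l) -> forall l', 'I_(num F l') -> k) : Prop :=
  forall l l' (r : 'I_(num F l)), (l' + n)%N = l.+1 ->
    psi l l' (eps r) = \sum_(s < num F l') kscale (b l r l' s) (eps s) /\
    forall s s' : 'I_(num F l'), b l r l' s != 0 -> b l r l' s' != 0 -> s = s'.

(* The i-component of g: it agrees with g on eps^n_i and kills the other
   generators. *)
Definition component (n : nat) (g : K n -> regular_bimodule L)
    (i : 'I_(num F n)) : cochain n :=
  K_ext (fun j => if j == i then g (eps j) else 0).

(* The bracket K_l -> Lambda, for l = n + m - 1. *)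
Definition bracket (n m : nat) (eta : cochain n) (theta : cochain m)
    (psi_eta : 'I_(num F n) -> forall l l', bihom (K l) (K l'))
    (psi_theta : 'I_(num F m) -> forall l l', bihom (K l) (K l'))
    (l : nat) (x : K l) : L :=
  \sum_(i < num F n) \sum_(j < num F m)
    ((component eta i (psi_theta j l n x) : L)
     - (-1) ^ ((m%:Z - 1) * (n%:Z - 1)) *: (component theta j (psi_eta i l m x) : L)).
End BimoduleResolution.

(* Main.v *)
(* [component] multiplies the prescribed values by o(f^n_i) and t(f^n_i). The
   generators satisfy eps = o eps t, hence so does every bimodule map evaluated
   at one, and these factors disappear: the i-component of eta selects the i-th
   coefficient of psi(eps^l_r) and multiplies it by eta(eps^n_i). *)
Require Import Defs.
From mathcomp Require Import all_boot all_order all_algebra.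

Set Implicit Arguments.
Unset Strict Implicit.
Unset Printing Implicit Defensive.

Import GRing.Theory.
Local Open Scope ring_scope.

Section Generators.
Variables (k : fieldType) (L : quiver_algebra k) (F : koszul_data L).

(** The only nonzero coordinate of [eps i] is the tensor of two idempotents; the two actions
    multiply its outer factors by those same idempotents. *)
Lemma eps_corner n (i : 'I_(num F n)) :
  vertex_class (f_org F i) *: eps i <* vertex_class (f_ter F i) = eps i.
Proof.
apply/ffunP => j; rewrite !ffunE; case: dfwithP => [|j' _]; last first.
  by rewrite scaler0 ract0l.
rewrite tensZ; apply: etrans (tensor_ractE _ _ _) _.
by congr tens; apply: val_inj => /=; exact: vertex_class_idem.
Qed.

Lemma bihom_eps_corner (M : bimodule L L) n (g : bihom (K F n) M) i :
  vertex_class (f_org F i) *: g (eps i) <* vertex_class (f_ter F i) = g (eps i).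
Proof. by rewrite -linearZ -bihom_ract eps_corner. Qed.

Lemma component_eps n (eta : bihom (K F n) (regular_bimodule L)) i j :
  component eta i (eps j) = if j == i then eta (eps j) else 0.
Proof.
rewrite K_ext_eps; case: eqP => _; first exact: bihom_eps_corner.
by rewrite scaler0 ract0l.
Qed.

Lemma component_sum_eps n (eta : bihom (K F n) (regular_bimodule L)) i
    (c : 'I_(num F n) -> k) :
  component eta i (\sum_s kscale (c s) (eps s)) = c i *: (eta (eps i) : L).
Proof.
rewrite linear_sum (bigD1 i) //= big1 => [|s si]; rewrite linearZ component_eps.
  rewrite eqxx addr0.
  (* In the regular bimodule [kscale c] is left multiplication by [c%:A]; here it becomes scaling by
     [c] over [k]. *)
  by apply: etrans (esym (scalerAl (c i) 1 (eta (eps i) : L))) _; rewrite mul1r.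
by rewrite (negPf si); exact: mulr0.
Qed.

(** [bracket] is a bare function, not a [bihom], so [bihom_eps_corner] does not apply to it
    directly. Each summand, however, is built from composites of two bimodule maps. *)
Lemma bracket_eps_corner n m eta theta psi_eta psi_theta l (r : 'I_(num F l)) :
  let br := @bracket k L F n m eta theta psi_eta psi_theta l (eps r) in
  vertex_class (f_org F r) * br * vertex_class (f_ter F r) = br.
Proof.
rewrite /= /bracket mulr_sumr mulr_suml; apply: eq_bigr => i _.
rewrite mulr_sumr mulr_suml; apply: eq_bigr => j _.
have corner p q (g : bihom (K F q) (regular_bimodule L)) (psi : bihom (K F p) (K F q)) s :
    vertex_class (f_org F s) * (g (psi (eps s)) : L) * vertex_class (f_ter F s) =
      g (psi (eps s)).
  (* Only the right-hand side is expanded; [g] then carries the idempotents outward. *)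
  by rewrite -{2}(bihom_eps_corner psi) bihom_ract linearZ.
by rewrite mulrBr mulrBl -scalerAr -scalerAl !corner.
Qed.
End Generators.

Theorem theorem4p21 (k : fieldType) (L : quiver_algebra k)
    (graded_L : graded L) (koszul_L : koszul L) (F : koszul_data L)
    (n m : nat)
    (eta : bihom (K F n) (regular_bimodule L))
    (theta : bihom (K F m) (regular_bimodule L))
    (eta_cocycle : cocycle eta) (theta_cocycle : cocycle theta)
    (lambda : 'I_(num F n) -> L) (beta : 'I_(num F m) -> L)
    (eta_eps : forall i, eta (eps i) = lambda i)
    (theta_eps : forall j, theta (eps j) = beta j)
    (lambda_path : forall i, exists a, lambda i = arrow_class a)
    (beta_path : forall j, exists a, beta j = arrow_class a)
    (psi_eta : 'I_(num F n) -> forall l l' : nat, bihom (K F l) (K F l'))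
    (psi_theta : 'I_(num F m) -> forall l l' : nat, bihom (K F l) (K F l'))
    (psi_eta_lifting :
       forall i, homotopy_lifting (component eta i) (psi_eta i))
    (psi_theta_lifting :
       forall j, homotopy_lifting (component theta j) (psi_theta j))
    (b_eta : 'I_(num F n) ->
       forall l : nat, 'I_(num F l) -> forall l' : nat, 'I_(num F l') -> k)
    (b_theta : 'I_(num F m) ->
       forall l : nat, 'I_(num F l) -> forall l' : nat, 'I_(num F l') -> k)
    (psi_eta_coefs : forall i, monomial_coefs n (psi_eta i) (b_eta i))
    (psi_theta_coefs : forall j, monomial_coefs m (psi_theta j) (b_theta j))
    (l : nat) (l_def : l.+1 = (n + m)%N) (r : 'I_(num F l)) :
  component (@bracket k L F n m eta theta psi_eta psi_theta l) r (eps r) =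
  \sum_(i < num F n) \sum_(j < num F m)
    (b_theta j l r n i *: lambda i
     - ((-1) ^ ((m%:Z - 1) * (n%:Z - 1)) * b_eta i l r m j) *: beta j).
Proof.
(* The outer component leaves the bracket value between the origin and terminus idempotents of
   [f^l_r], which the next step removes. *)
rewrite /component K_ext_eps eqxx.
apply: etrans (bracket_eps_corner _ _ _ _ _) _.
apply: eq_bigr => i _; apply: eq_bigr => j _.
(* [psi_theta j] lowers degrees by [m - 1], so from [l = n + m - 1] it lands in degree [n];
   symmetrically, [psi_eta i] lands in degree [m]. *)
have [-> _] := psi_theta_coefs j l n r (esym l_def).
have [-> _] := psi_eta_coefs i l m r (etrans (addnC m n) (esym l_def)).
by rewrite !component_sum_eps eta_eps theta_eps scalerA.
Qed.
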